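(* Let $d\ge1$ and $\mu\ge0$. There exists a probability measure $\mathrm{PPM}(\mu,d)$ on the ordered-list space $\mathrm{PointList}(d)=\coprod_{n\ge0}([0,1]^d)^n$ such that the count $N$ (the length of the list) has law $\mathrm{Poisson}(\mu)$ and, conditional on $N=n$, the $n$ listed locations are iid $\mathrm{Uniform}([0,1]^d)$. Moreover, the pushforward of $\mathrm{PPM}(\mu,d)$ under the map $(x_1,\dots,x_n)\mapsto\sum_{i=1}^n\delta_{x_i}$, sending each list to its counting measure, is the law of the homogeneous Poisson point process on $[0,1]^d$ with mean total count $\mu$.
   Context: $\mathrm{PointList}(d)$ is the disjoint union over $n\ge0$ of the spaces $([0,1]^d)^n$ of ordered $n$-tuples (functions $\{0,\dots,n-1\}\to[0,1]^d$), with the disjoint-union $\sigma$-algebra of the Borel product $\sigma$-algebras. The homogeneous Poisson point process on $[0,1]^d$ with mean total count $\mu$ is the random counting measure $\Xi$ such that for pairwise disjoint measurable $B_1,\dots,B_m\subseteq[0,1]^d$ the counts $\Xi(B_1),\dots,\Xi(B_m)$ are independent, with $\Xi(B_i)\sim\mathrm{Poisson}(\mu\,\mathrm{Leb}(B_i))$. $\mathrm{Poisson}(0)=\delta_0$; conditioning on $N=n$ refers to those $n$ with $\mathbb P(N=n)>0$. *)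

(* Defs.v *)
From HB Require Import structures.
From mathcomp Require Import all_boot all_order all_algebra.
From mathcomp Require Import all_classical all_reals all_analysis.
From mathcomp Require Import measurable_realfun.

Set Implicit Arguments.
Unset Strict Implicit.
Unset Printing Implicit Defensive.

Import Order.TTheory GRing.Theory Num.Theory.

Local Open Scope classical_set_scope.
Local Open Scope ring_scope.
Local Open Scope ereal_scope.

Section probability_notions.
Context {dO} {Omega : measurableType dO} {R : realType}.

Definition has_law {dT} {T : measurableType dT}
    (P : probability Omega R) (X : Omega -> T) (Q : set T -> \bar R) : Prop :=
  measurable_fun [set: Omega] X /\
  forall A, measurable A -> P (X @^-1` A) = Q A.

Definition independent {dT} {T : measurableType dT} {I : finType}
    (P : probability Omega R) (X : I -> Omega -> T) : Prop :=
  (forall i, measurable_fun [set: Omega] (X i)) /\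
  forall A : I -> set T, (forall i, measurable (A i)) ->
    P (\bigcap_(i in [set: I]) (X i @^-1` A i)) = \prod_i P (X i @^-1` A i).

Definition iid {dT} {T : measurableType dT} {I : finType}
    (P : probability Omega R) (X : I -> Omega -> T) (Q : set T -> \bar R) :=
  independent P X /\ forall i, has_law P (X i) Q.

(* A |-> P (A `&` E) / P E if P E != 0, and the irrelevant default P if
   P E = 0. *)
Definition conditional (P : probability Omega R) (E : set Omega)
    (mE : measurable E) : probability Omega R :=
  mnormalize (mrestr P mE) P.

End probability_notions.

Section product_probability.
Context {dT} {T : measurableType dT} {R : realType}.

Definition tcons n (x : T * n.-tuple T) : n.+1.-tuple T :=
  [tuple of x.1 :: x.2].

Lemma measurable_tcons n : measurable_fun [set: T * n.-tuple T] (@tcons n).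
Proof. by apply: measurable_cons. Qed.

HB.instance Definition _ n :=
  isMeasurableFun.Build _ _ _ _ (@tcons n) (@measurable_tcons n).

Fixpoint power_prob (P : probability T R) n : probability (n.-tuple T) R :=
  match n with
  | 0 => \d_([tuple] : 0.-tuple T)
  | m.+1 => distribution (P \x power_prob P m) (@tcons m)
  end.

Lemma power_prob_box (P : probability T R) n (A : 'I_n -> set T) :
  (forall i, measurable (A i)) ->
  power_prob P n [set x | forall i, A i (tnth x i)] = \prod_(i < n) P (A i).
Proof.
elim: n A => [|n IH] A mA.
  rewrite big_ord0 /= diracE mem_set//.
  by move=> [].
rewrite big_ord_recl/= /distribution /pushforward.
rewrite -IH// -product_measure1E//; last first.
  rewrite (_ : [set _ | _] = \bigcap_(i in [set: 'I_n])
      ((fun x : n.-tuple T => tnth x i) @^-1` A (lift ord0 i))).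
    apply: fin_bigcap_measurable => // i _.
    by rewrite -[X in measurable X]setTI; exact: measurable_tnth.
  by apply/seteqP; split => x /= h i => [_|]; exact: h.
congr (_ _); apply/seteqP; split => -[x y] /=.
- by move=> h; split => [|i]; [exact: (h ord0)|have := h (lift ord0 i);
    rewrite tnthS].
- move=> [Ax Ay] i; have [j ->|->] := unliftP ord0 i.
  + by rewrite tnthS; exact: Ay.
  + exact: Ax.
Qed.

End product_probability.

Section cube.
Context (R : realType).

Definition unit_interval := {x : R | (0 <= x <= 1)%R}.

Lemma unit_interval0 : (0 <= (0 : R) <= 1)%R.
Proof. by rewrite lexx ler01. Qed.

HB.instance Definition _ := Choice.on unit_interval.
HB.instance Definition _ :=
  isPointed.Build unit_interval (exist _ 0%R unit_interval0).

Definition unit_val (x : unit_interval) : R := val x.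

HB.instance Definition _ := Measurable.copy unit_interval
  (g_sigma_algebra_preimageType unit_val).

Definition unit_lebesgue (A : set unit_interval) : \bar R :=
  lebesgue_measure (unit_val @` A).

Lemma unit_val_inj : injective unit_val.
Proof. exact: val_inj. Qed.

Lemma range_unit_val : range unit_val = `[0%R, 1%R]%classic.
Proof.
apply/seteqP; split => [_ [x _ <-]|x] /=; rewrite in_itv/=; first by case: x.
by move=> x01; exists (exist _ x x01).
Qed.

Lemma measurable_image_unit_val (A : set unit_interval) :
  measurable A -> measurable (unit_val @` A).
Proof.
move=> [B mB <-]; rewrite setTI.
have -> : unit_val @` (unit_val @^-1` B) = B `&` range unit_val.
  apply/seteqP; split => [_ [x Bx <-]|y [By [x _ xy]]].
    by split => //; exists x.
  by exists x => //; rewrite /preimage/= xy.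
by rewrite range_unit_val; exact: measurableI.
Qed.

Let unit_lebesgue0 : unit_lebesgue set0 = 0.
Proof. by rewrite /unit_lebesgue image_set0 measure0. Qed.

Let unit_lebesgue_ge0 A : 0 <= unit_lebesgue A.
Proof. exact: measure_ge0. Qed.

Let unit_lebesgue_sigma_additive : semi_sigma_additive unit_lebesgue.
Proof.
move=> F mF tF mUF; rewrite /unit_lebesgue image_bigcup.
apply: measure_semi_sigma_additive.
- by move=> i; exact: measurable_image_unit_val.
- apply/trivIsetP => i j _ _ ij; apply/seteqP; split => // x.
  move=> [[y Fiy yx] [z Fjz zx]].
  have yz : y = z by apply: unit_val_inj; rewrite yx zx.
  have : (F i `&` F j) y by split; [|rewrite yz].
  by move/trivIsetP : tF => ->.
- by rewrite -image_bigcup; exact: measurable_image_unit_val.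
Qed.

HB.instance Definition _ := isMeasure.Build _ _ _ unit_lebesgue
  unit_lebesgue0 unit_lebesgue_ge0 unit_lebesgue_sigma_additive.

Let unit_lebesgueT : unit_lebesgue [set: unit_interval] = 1.
Proof.
by rewrite /unit_lebesgue range_unit_val lebesgue_measure_itv/= lte01 oppr0 adde0.
Qed.

HB.instance Definition _ :=
  Measure_isProbability.Build _ _ _ unit_lebesgue unit_lebesgueT.

Definition cube (d : nat) := d.-tuple unit_interval.

HB.instance Definition _ d := Measurable.on (cube d).

(* Lebesgue measure on [0,1]^d; as it has total mass 1, it is also the
   distribution Uniform([0,1]^d). *)
Definition cube_lebesgue (d : nat) : probability (cube d) R :=
  power_prob unit_lebesgue d.

End cube.

Definition point_list_display : measure_display -> measure_display.
Proof. exact. Qed.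

Section point_list.
Context {dT} (T : measurableType dT).

Definition point_list := {n : nat & n.-tuple T}.

HB.instance Definition _ := Choice.on point_list.
HB.instance Definition _ := isPointed.Build point_list
  (existT (fun n => n.-tuple T) 0%N [tuple]).

Definition list_of n (x : n.-tuple T) : point_list :=
  existT (fun n => n.-tuple T) n x.

Definition measurable_point_list : set (set point_list) :=
  [set A | forall n, measurable (@list_of n @^-1` A)].

Let measurable_point_list0 : measurable_point_list set0.
Proof. by move=> n; rewrite preimage_set0. Qed.

Let measurable_point_listC A :
  measurable_point_list A -> measurable_point_list (~` A).
Proof. by move=> mA n; rewrite preimage_setC; apply: measurableC; exact: mA. Qed.

Let measurable_point_list_bigcup (F : (set point_list)^nat) :
  (forall i, measurable_point_list (F i)) ->
  measurable_point_list (\bigcup_i F i).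
Proof.
by move=> mF n; rewrite preimage_bigcup; apply: bigcup_measurable => i _; exact: mF.
Qed.

HB.instance Definition _ := @isMeasurable.Build (point_list_display dT) point_list
  measurable_point_list measurable_point_list0 measurable_point_listC
  measurable_point_list_bigcup.

Lemma measurable_fun_point_list {dS} {S : measurableType dS}
    (f : point_list -> S) :
  (forall n, measurable_fun [set: n.-tuple T] (f \o @list_of n)) ->
  measurable_fun [set: point_list] f.
Proof.
move=> mf _ A mA; rewrite setTI.
suff : measurable_point_list (f @^-1` A) by [].
by move=> n; have := mf n measurableT A mA; rewrite setTI.
Qed.

Definition length (l : point_list) : nat := tag l.

Lemma measurable_length : measurable_fun [set: point_list] length.
Proof. by apply: measurable_fun_point_list => n; exact: measurable_cst. Qed.

Lemma measurable_length_eq (n : nat) : measurable [set l | length l = n].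
Proof.
have := @measurable_length measurableT [set n] Logic.I.
by rewrite setTI.
Qed.

(* The default value is used only for i >= length l. *)
Definition location (i : nat) (l : point_list) : T := nth point (tagged l) i.

End point_list.

Definition counting_display : measure_display.
Proof. by constructor. Qed.

Section counting_measure.
Context {dT} (T : measurableType dT) (R : realType).

(* Integer-valued measures; as only finite values are allowed, this is the
   notion of (locally finite) counting measure on a compact space such as
   [0,1]^d. *)
Definition is_counting (nu : set T -> \bar R) : Prop :=
  forall B, measurable B -> exists k : nat, nu B = k%:R%:E.

Record counting_measure := CountingMeasure {
  counting_val :> {measure set T -> \bar R} ;
  counting_valP : is_counting counting_val }.

HB.instance Definition _ := gen_eqMixin counting_measure.
HB.instance Definition _ := gen_choiceMixin counting_measure.

Lemma is_counting_mzero : is_counting (@mzero _ T R).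
Proof. by move=> B _; exists 0%N. Qed.

HB.instance Definition _ :=
  isPointed.Build counting_measure (CountingMeasure is_counting_mzero).

Definition counting_evaluations : set (set counting_measure) :=
  [set E | exists2 B : set T, measurable B &
     exists2 A : set (\bar R), measurable A &
       E = [set nu : counting_measure | A (nu B)]].

Let counting_measurable : set (set counting_measure) :=
  <<s counting_evaluations >>.

Let counting_measurable0 : counting_measurable set0.
Proof. exact: sigma_algebra0. Qed.

Let counting_measurableC A :
  counting_measurable A -> counting_measurable (~` A).
Proof. exact: sigma_algebraC. Qed.

Let counting_measurable_bigcup (F : (set counting_measure)^nat) :
  (forall i, counting_measurable (F i)) ->
  counting_measurable (\bigcup_i F i).
Proof. exact: sigma_algebra_bigcup. Qed.

HB.instance Definition _ := @isMeasurable.Build counting_display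
  counting_measure counting_measurable counting_measurable0
  counting_measurableC counting_measurable_bigcup.

Definition dirac_sum (l : point_list T) : {measure set T -> \bar R} :=
  msum (fun k => \d_(location k l)) (length l).

Lemma dirac_sum_counting l : is_counting (dirac_sum l).
Proof.
move=> B _; exists (\sum_(k < length l) (location k l \in B))%N.
by rewrite natr_sum -sumEFin; apply: eq_bigr => k _; rewrite /= diracE.
Qed.

Definition list_to_measure (l : point_list T) : counting_measure :=
  CountingMeasure (@dirac_sum_counting l).

Lemma measurable_list_to_measure :
  measurable_fun [set: point_list T] list_to_measure.
Proof.
apply: (@measurability _ _ _ _ _ _ counting_evaluations) => //.
move=> _ [_ [B mB [A mA ->]] <-].
have : measurable_fun [set: point_list T] (fun l => list_to_measure l B).
  apply: measurable_fun_point_list => n.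
  rewrite /comp /= /msum /=; apply: emeasurable_sum => k.
  have -> : (fun x : n.-tuple T => \d_(location k (list_of x)) B : \bar R) =
            (fun y => \d_y B) \o (fun x => tnth x k).
    by apply/funext => x /=; rewrite (tnth_nth point).
  apply: measurableT_comp; last exact: measurable_tnth.
  exact: measurable_fun_dirac.
by move=> /(_ measurableT A mA).
Qed.

HB.instance Definition _ := isMeasurableFun.Build _ _ _ _
  list_to_measure measurable_list_to_measure.

End counting_measure.

Section poisson_process.
Context {R : realType} {d : nat}.

(* poisson_prob ignores its second argument, and is \d_0 for rate 0. *)
Definition poisson (rate : R) : set nat -> \bar R := poisson_prob rate 0%N.

(* The counts Xi(B_i) are random variables in \bar R, so Poisson(rate) is
   transported from nat to \bar R. *)
Definition is_poisson_process {dO} {Omega : measurableType dO}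
    (mu : R) (P : probability Omega R)
    (Xi : {RV P >-> counting_measure (cube R d) R}) : Prop :=
  forall (m : nat) (B : 'I_m -> set (cube R d)),
    (forall i, measurable (B i)) -> trivIset [set: 'I_m] B ->
    independent P (fun i omega => Xi omega (B i)) /\
    forall i, has_law P (fun omega => Xi omega (B i))
      (pushforward (poisson (mu * fine (cube_lebesgue R d (B i))))
        (fun k : nat => k%:R%:E : \bar R)).

Arguments is_poisson_process {dO Omega} mu P Xi.

(* The process is only determined up to its law: Q is its law when some
   realization exists and every realization has law Q. *)
Definition is_law_of_poisson_process (mu : R)
    (Q : probability (counting_measure (cube R d) R) R) : Prop :=
  (exists dO (Omega : measurableType dO) (P : probability Omega R)
      (Xi : {RV P >-> counting_measure (cube R d) R}),
    is_poisson_process mu P Xi /\ has_law P Xi Q) /\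
  (forall dO (Omega : measurableType dO) (P : probability Omega R)
      (Xi : {RV P >-> counting_measure (cube R d) R}),
    is_poisson_process mu P Xi -> has_law P Xi Q).

End poisson_process.

(* Main.v *)
(* The list measure is the Poisson mixture over n of the n-fold powers of the
   uniform law. For a measurable partition (B_i) of the space, the event
   "B_i contains k_i points for every i" forces n = sum_i k_i, so only one term
   of the mixture survives; there the multinomial probability n! prod_i p_i^k_i / k_i!
   cancels the n! of the Poisson weight, and exp(- mu) = prod_i exp(- mu p_i)
   makes the result a product of Poisson probabilities. A disjoint family is
   completed to a partition by its complement.
   Two Poisson processes have the same law because finitely many counts are
   functions of the counts of the atoms generated by the sets involved, which
   are disjoint, and the cylinder events form a pi-system generating the
   sigma-algebra. *)
Require Import Defs.
From HB Require Import structures.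
From mathcomp Require Import all_boot all_order all_algebra.
From mathcomp Require Import all_classical all_reals all_analysis.
From mathcomp Require Import measurable_realfun.

Set Implicit Arguments.
Unset Strict Implicit.
Unset Printing Implicit Defensive.

Import Order.TTheory GRing.Theory Num.Theory.

Local Open Scope classical_set_scope.
Local Open Scope ring_scope.
Local Open Scope ereal_scope.

(** * Counting the points of a list that fall in a set *)

Section occurrences.
Context {dT} {T : measurableType dT} (R : realType).

Definition occ (B : set T) (s : seq T) : nat := count (fun x => x \in B) s.

Lemma list_to_measureE (l : point_list T) (B : set T) :
  list_to_measure R l B = (occ B (tagged l))%:R%:E.
Proof.
case: l => n x; rewrite /= /dirac_sum /msum /length /=.
rewrite /occ -sum1_count big_tuple [in RHS]big_mkcond/= natr_sum -sumEFin.
apply: eq_bigr => i _; rewrite diracE /location/= (tnth_nth point).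
by case: (_ \in _).
Qed.

Lemma measurable_counting_eval (B : set T) (A : set \bar R) :
  measurable B -> measurable A ->
  measurable [set nu : counting_measure T R | A (nu B)].
Proof. by move=> mB mA; apply: sub_sigma_algebra; exists B => //; exists A. Qed.

Lemma natr_EFin_inj : injective (fun k : nat => k%:R%:E : \bar R).
Proof. by move=> m n [] /eqP; rewrite eqr_nat => /eqP. Qed.

(** Every subset of [nat] is a countable union of singletons. The fibre over [k] is the preimage
    under [list_to_measure] of an evaluation event, because [k |-> k%:R%:E] is injective. *)
Lemma measurable_occ (B : set T) : measurable B ->
  measurable_fun [set: point_list T] (fun l : point_list T => occ B (tagged l)).
Proof.
move=> mB _ A _; rewrite setTI -[A]image_id -bigcup_imset1 preimage_bigcup.
apply: bigcup_measurable => k Ak.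
rewrite (_ : _ @^-1` _ = list_to_measure R @^-1`
    [set nu | [set k%:R%:E] (nu B)]).
  rewrite -[X in measurable X]setTI; apply: measurable_list_to_measure => //.
  exact: measurable_counting_eval.
apply/seteqP; split => l.
  by move=> <-; rewrite /= -/(list_to_measure R l B) list_to_measureE.
by rewrite /= -/(list_to_measure R l B) list_to_measureE => /natr_EFin_inj.
Qed.

End occurrences.

Lemma measure_finT_bigcup d (T : measurableType d) (R : realType)
    (m : {measure set T -> \bar R}) (I : finType) (F : I -> set T) :
  (forall i, measurable (F i)) -> trivIset [set: I] F ->
  m (\bigcup_i F i) = \sum_i m (F i).
Proof.
move=> mF tF; rewrite measure_fin_bigcup//; last exact: finite_finset.
etransitivity; last exact/esym/fsbig_seq/index_enum_uniq.
apply: eq_fsbigl; apply/seteqP; split => i //= _; exact: mem_index_enum.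
Qed.

(** * The multinomial law of the block counts of an iid tuple *)

Section multinomial.
Context {dT} {T : measurableType dT} {R : realType} (P : probability T R).
Context (I : finType) (B : I -> set T).
Hypotheses (mB : forall i, measurable (B i)) (tB : trivIset [set: I] B)
  (cB : \bigcup_i B i = [set: T]).

Let p i : R := fine (P (B i)).

Lemma measurable_occ_tuple n (k : I -> nat) :
  measurable [set x : n.-tuple T | forall i, occ (B i) x = k i].
Proof.
rewrite (_ : [set _ | _] = \bigcap_(i in [set: I])
    (@list_of _ T n @^-1` [set l : point_list T | occ (B i) (tagged l) = k i])); last first.
  by apply/seteqP; split => x /= h i => [_|]; exact: h.
apply: fin_bigcap_measurable => // i _.
have := @measurable_occ _ T R _ (mB i) measurableT [set k i] Logic.I.
by rewrite setTI => /(_ n).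
Qed.

Lemma sumn_pred1D (k : I -> nat) i : (0 < k i)%N ->
  ((\sum_j (k j - (j == i))).+1 = \sum_j k j)%N.
Proof.
move=> ki; rewrite (bigD1 i)//= [RHS](bigD1 i)//= eqxx -addSn subn1 prednK//.
congr addn; apply: eq_bigr => j /negPf ->; by rewrite subn0.
Qed.

(** Induction on [n], splitting on the block that contains the first point: the remaining [n] points
    must realize [k] lowered by one in that block. Summing over the blocks turns [n!] into
    [(n+1)!]. *)
Lemma power_prob_occ n (k : I -> nat) :
  power_prob P n [set x : n.-tuple T | forall i, occ (B i) x = k i] =
  (if (\sum_i k i == n)%N then n`!%:R * \prod_i (p i ^+ k i / (k i)`!%:R)
   else 0)%R%:E.
Proof.
elim: n k => [|n IH] k.
  rewrite /= diracE sum_nat_eq0; case: ifPn => [/forallP k0|].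
    rewrite mem_set; last by move=> i; exact/esym/eqP/k0.
    rewrite big1 ?mulr1// => i _; have /eqP -> := k0 i.
    by rewrite expr0 fact0 divr1.
  move/forallPn => [i ki]; rewrite memNset// => /(_ i) /esym/eqP.
  by move: ki => /= /negPf ->.
have uB i j y : B i y -> B j y -> i = j.
  by move=> Bi Bj; apply: tB => //; exists y.
have inB i j y : B i y -> (y \in B j) = (j == i).
  move=> Bi; apply/idP/eqP => [/set_mem Bj|->]; last exact/mem_set.
  exact: uB Bj Bi.
(* [F i]: the first point lies in [B i]. *)
pose F i := B i `*` [set x : n.-tuple T | forall j, ((j == i) + occ (B j) x = k j)%N].
(* Subtraction in [nat] truncates, so lowering [k i] by one is faithful only if [k i] is positive.
   If it is 0, the first point cannot lie in [B i]. *)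
have FE i : F i = if (0 < k i)%N then
    B i `*` [set x : n.-tuple T | forall j, occ (B j) x = (k j - (j == i))%N]
    else set0.
  case: ifPn => [ki|].
    congr (_ `*` _); apply/seteqP; split => x /= h j.
      by rewrite -h addKn.
    rewrite h; case: eqVneq => [->|_]; last by rewrite subn0.
    by rewrite subnKC.
  rewrite -eqn0Ngt => /eqP k0; apply/seteqP; split => // -[y x] [_ /= /(_ i)].
  by rewrite eqxx k0.
have mF i : measurable (F i).
  rewrite FE; case: ifPn => // _; apply: measurableX => //.
  exact: measurable_occ_tuple.
have tF : trivIset [set: I] F.
  by move=> i j _ _ [[y x] [[/= Bi _] [/= Bj _]]]; exact: uB Bi Bj.
rewrite /= /distribution /pushforward.
rewrite (_ : _ @^-1` _ = \bigcup_i F i); last first.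
  apply/seteqP; split => [[y x] /= h|[y x] [i _ [/= Bi h]] j].
    have [i _ Bi] : (\bigcup_i B i) y by rewrite cB.
    by exists i => //; split => //= j; rewrite -h /occ/= (inB i).
  by rewrite -h /occ/= (inB i).
rewrite measure_finT_bigcup//.
pose q := (\prod_i (p i ^+ k i / (k i)`!%:R))%R.
(* The factor [k i] comes from p * p^(k-1) / (k-1)! = k * p^k / k!; for [k i = 0] it also gives the
   right value, 0. *)
have PF i : (P \x power_prob P n) (F i) =
  (if (\sum_i k i == n.+1)%N then (k i)%:R * (n`!%:R * q) else 0)%R%:E.
  rewrite FE; case: ifPn => [ki|]; last first.
    by rewrite -eqn0Ngt => /eqP ->; rewrite measure0 mul0r if_same.
  have -> : (P \x power_prob P n) (B i `*` [set x : n.-tuple T |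
      forall j, occ (B j) x = (k j - (j == i))%N]) = (p i)%:E *
      power_prob P n [set x : n.-tuple T |
        forall j, occ (B j) x = (k j - (j == i))%N].
    rewrite product_measure1E//; last exact: measurable_occ_tuple.
    by congr (_ * _); rewrite fineK// fin_num_measure.
  rewrite (IH (fun j => k j - (j == i))%N).
  rewrite -(sumn_pred1D ki) eqSS -EFinM.
  congr EFin; case: ifPn => // _; last by rewrite mulr0.
  rewrite mulrCA [RHS]mulrCA; congr (_ * _)%R.
  rewrite /q (bigD1 i)//= [in RHS](bigD1 i)//= eqxx !mulrA; congr (_ * _)%R; last first.
    by apply: eq_bigr => j /negPf ->; rewrite subn0.
  case: (k i) ki => // m _; rewrite subn1/= factS natrM.
  by rewrite -mulf_div mulfV ?pnatr_eq0// mul1r exprS.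
(* The factors [k i] add up to [n.+1], which completes [n!] to [(n.+1)!]. *)
rewrite (eq_bigr _ (fun i _ => PF i)) sumEFin; congr EFin.
case: ifPn => [/eqP kn|_]; last by rewrite big1.
by rewrite -mulr_suml -natr_sum kn factS natrM mulrA.
Qed.

End multinomial.

(** * Point masses of the Poisson law *)

Section poisson_law.
Context {R : realType}.
Implicit Types (mu : R) (k : nat).

Lemma poisson_ge0 mu (A : set nat) : 0 <= poisson mu A.
Proof. exact: (measure_ge0 (poisson_prob mu 0)). Qed.

Lemma poisson_fin_num mu (A : set nat) : poisson mu A \is a fin_num.
Proof. exact: (fin_num_measure (poisson_prob mu 0)). Qed.

Lemma poisson_sum_set1 mu (A : set nat) :
  poisson mu A = \sum_(k <oo | k \in A) poisson mu [set k].
Proof.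
rewrite -[in LHS](image_id A) -bigcup_imset1.
apply: (measure_bigcup (poisson_prob mu 0)) => // i j _ _.
by move=> [x [-> ->]].
Qed.

(** Rate 0 is a separate case of [poisson_prob], a Dirac mass at 0; the usual formula still covers
    it because 0^0 = 1. *)
Lemma poisson_set1 mu k : (0 <= mu)%R ->
  poisson mu [set k] = (mu ^+ k / k`!%:R * expR (- mu))%:E.
Proof.
rewrite le_eqVlt => /predU1P[<-|mu0]; rewrite /poisson /poisson_prob.
  rewrite ltxx diracE expr0n oppr0 expR0 mulr1; case: k => [|k].
    by rewrite fact0 divr1 mem_set.
  by rewrite mul0r memNset.
by rewrite mu0 esum_set1 ?lee_fin ?poisson_pmf_ge0// /poisson_pmf mu0.
Qed.

End poisson_law.

(** * The Poisson mixture of powers on the space of lists *)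

Lemma measurable_list_of {dT} {T : measurableType dT} n :
  measurable_fun [set: n.-tuple T] (@list_of _ T n).
Proof. by move=> _ A mA; rewrite setTI; exact: mA. Qed.

HB.instance Definition _ dT (T : measurableType dT) n :=
  isMeasurableFun.Build _ _ _ _ (@list_of _ T n) (@measurable_list_of _ T n).

Section poisson_list.
Context {dT} {T : measurableType dT} {R : realType}.
Variables (mu : R) (P : probability T R).

(** [mscale] takes a nonnegative real, so the extended-real Poisson mass is passed through [fine];
    [poisson_fin_num] shows that nothing is lost. *)
Let weight n : {nonneg R} := NngNum (fine_ge0 (poisson_ge0 mu [set n])).

Definition poisson_list : set (point_list T) -> \bar R :=
  mseries (fun n =>
    mscale (weight n) (distribution (power_prob P n) (@list_of _ T n))) 0.

HB.instance Definition _ := Measure.on poisson_list.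

Lemma poisson_listE (A : set (point_list T)) : poisson_list A =
  \sum_(n <oo) poisson mu [set n] * power_prob P n (@list_of _ T n @^-1` A).
Proof.
apply: eq_eseriesr => n _; congr (_ * _).
exact: (fineK (poisson_fin_num mu [set n])).
Qed.

Lemma poisson_list_length (A : set nat) :
  poisson_list (@length _ T @^-1` A) = poisson mu A.
Proof.
rewrite poisson_listE poisson_sum_set1 [RHS]eseries_mkcond.
apply: eq_eseriesr => n _; rewrite /preimage /length/=; case: ifPn => nA.
  rewrite (_ : [set _ | _] = setT) ?probability_setT ?mule1//.
  by apply/seteqP; split => // x _ /=; exact/set_mem.
rewrite (_ : [set _ | _] = set0) ?measure0 ?mule0//.
by apply/seteqP; split => // x /= /mem_set An; rewrite An in nA.
Qed.

Let poisson_listT : poisson_list [set: point_list T] = 1.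
Proof.
rewrite -(preimage_setT (@length _ T)) poisson_list_length.
exact: (probability_setT (poisson_prob mu 0)).
Qed.

HB.instance Definition _ :=
  Measure_isProbability.Build _ _ _ poisson_list poisson_listT.

(** All terms of the mixture but the one of index [n] see an empty preimage. *)
Lemma poisson_list_fixed_length n (A : set (point_list T)) :
  (forall l, A l -> length l = n) ->
  poisson_list A = poisson mu [set n] * power_prob P n (@list_of _ T n @^-1` A).
Proof.
move=> An; rewrite poisson_listE (@nneseriesD1 _ _ n)//; last first.
  by move=> k _; rewrite mule_ge0 ?poisson_ge0.
rewrite eseries0 ?adde0// => k _ /andP[_ kn].
rewrite (_ : _ @^-1` _ = set0) ?measure0 ?mule0//.
by apply/seteqP; split => // x /An /= /eqP; rewrite /length/= (negPf kn).
Qed.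

Lemma measurable_location i :
  measurable_fun [set: point_list T] (@location _ T i).
Proof.
apply: measurable_fun_point_list => n; have [ni|ni] := leqP n i.
  (* On tuples too short to have an entry [i], the location is the default [point], a constant. *)
  apply: (eq_measurable_fun (cst point)) => // x _.
  by rewrite /comp /location nth_default// size_tuple.
apply: (eq_measurable_fun (fun x : n.-tuple T => tnth x (Ordinal ni))).
  by move=> x _; rewrite /comp /location/= (tnth_nth point).
exact: measurable_tnth.
Qed.

Lemma conditional_poisson_list n (A : set (point_list T)) :
  0 < poisson_list [set l | length l = n] ->
  conditional poisson_list (measurable_length_eq n) A =
  power_prob P n (@list_of _ T n @^-1` A).
Proof.
move=> p0.
have pE : poisson_list [set l | length l = n] = poisson mu [set n].
  exact: (poisson_list_length [set n]).
(* The conditioning event has a mass that is neither 0 nor infinite, so [mnormalize] does not return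
   its default; the Poisson weight then cancels. *)
rewrite /conditional /= /mnormalize/= /mrestr setTI gt_eqF//= pE.
have /fin_numP[_ /negPf ->] := poisson_fin_num mu [set n].
rewrite (poisson_list_fixed_length (n := n)); last by move=> l [].
rewrite muleAC -{1}(fineK (poisson_fin_num mu [set n])) -EFinM mulfV; last first.
  by rewrite gt_eqF// fine_gt0// -pE p0 pE ltey_eq poisson_fin_num.
rewrite mul1e; congr (power_prob P n _).
by apply/seteqP; split => [x []|x Ax] //; split.
Qed.

Lemma iid_poisson_list n :
  0 < poisson_list [set l | length l = n] ->
  iid (conditional poisson_list (measurable_length_eq n))
      (fun i : 'I_n => @location _ T i) P.
Proof.
move=> p0.
have box (A : 'I_n -> set T) : (forall i, measurable (A i)) ->
    conditional poisson_list (measurable_length_eq n)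
      (\bigcap_(i in [set: 'I_n]) (@location _ T i @^-1` A i)) = \prod_i P (A i).
  move=> mA; rewrite conditional_poisson_list// -power_prob_box//.
  congr (power_prob P n _); apply/seteqP; split => x /= h i => [|_].
    by have := h i Logic.I; rewrite /location/= (tnth_nth point).
  by rewrite /location /= -tnth_nth; exact: h.
have marginal (i : 'I_n) A : measurable A ->
    conditional poisson_list (measurable_length_eq n)
      (@location _ T i @^-1` A) = P A.
  (* A marginal is the box whose other sides are the whole space; each of these contributes a factor
     1. *)
  move=> mA; pose F j := if j == i then A else [set: T].
  have mF j : measurable (F j) by rewrite /F; case: ifP.
  have := box F mF; rewrite (bigD1 i)//= {2}/F eqxx big1 ?mule1; last first.
    by move=> j /negPf ji; rewrite /F ji probability_setT.
  move=> <-; congr (conditional _ _ _); apply/seteqP; split => l /=.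
    by move=> Al j _; rewrite /F /preimage/=; case: eqP => [->|].
  by move=> /(_ i Logic.I); rewrite /F eqxx.
split; last by move=> i; split; [exact: measurable_location|exact: marginal].
split=> [i|A mA]; first exact: measurable_location.
by rewrite box//; apply: eq_bigr => i _; rewrite marginal.
Qed.

End poisson_list.

(** * Joint law of the counts over a disjoint family *)

Section occurrence_law.
Context {dT} {T : measurableType dT} {R : realType}.
Variables (mu : R) (P : probability T R) (mu0 : (0 <= mu)%R).

Let N (B : set T) (l : point_list T) : nat := occ B (tagged l).

Let poisson_list_occ_set1 (I : finType) (B : I -> set T) (k : I -> nat) :
  (forall i, measurable (B i)) -> trivIset [set: I] B ->
  \bigcup_i B i = [set: T] ->
  poisson_list mu P [set l | forall i, N (B i) l = k i] =
  \prod_i poisson (mu * fine (P (B i))) [set k i].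
Proof.
move=> mB tB cB; pose p i := fine (P (B i)).
have p0 i : (0 <= p i)%R by rewrite fine_ge0.
have p1 : (\sum_i p i = 1)%R.
  apply: EFin_inj; rewrite -sumEFin -(probability_setT P) -cB.
  rewrite measure_finT_bigcup//; apply: eq_bigr => i _.
  by rewrite fineK// fin_num_measure.
(* Each point lies in exactly one block, so the counts determine the length. *)
have lenE l : (\sum_i N (B i) l = length l)%N.
  case: l => n x; rewrite /N /occ /length/= -[RHS](size_tuple x).
  elim: (tval x) => [|y s IH] /=; first by rewrite big1.
  rewrite big_split/= IH -add1n; congr addn.
  have [i _ Bi] : (\bigcup_i B i) y by rewrite cB.
  rewrite (bigD1 i)//= mem_set// big1// => j /negPf ji.
  apply/eqP; rewrite eqb0; apply/negP => /set_mem Bj.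
  by move: ji; rewrite (tB j i)// ?eqxx//; exists y.
rewrite (@poisson_list_fixed_length _ _ _ _ _ (\sum_i k i)%N); last first.
  by move=> l /= kE; rewrite -lenE; apply: eq_bigr => i _; exact: kE.
have -> : @list_of _ T (\sum_i k i)%N @^-1` [set l | forall i, N (B i) l = k i] =
  [set x | forall i, occ (B i) x = k i] by [].
rewrite power_prob_occ// eqxx poisson_set1// -EFinM.
have -> : \prod_i poisson (mu * fine (P (B i))) [set k i] = \prod_i
    (mu ^+ k i * (p i ^+ k i / (k i)`!%:R) * expR (- (mu * p i)))%:E.
  apply: eq_bigr => i _; rewrite poisson_set1; last by rewrite mulr_ge0// p0.
  by rewrite exprMn !mulrA.
(* The exponents add up to [- mu] since the [p i] sum to 1, and the powers of [mu] combine to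
   [mu ^+ \sum_i k i]. What is left is to cancel the factorial. *)
rewrite prodEFin; congr EFin; rewrite !big_split/= -expR_sum -/p.
rewrite sumrN -mulr_sumr p1 mulr1 -expr_sum.
by rewrite [RHS]mulrAC [X in (X * _)%R = _]mulrAC -[LHS]mulrA mulKf//.
Qed.

Let measurable_occ_box (I : finType) (B : I -> set T) (A : I -> set nat) :
  (forall i, measurable (B i)) ->
  measurable [set l | forall i, A i (N (B i) l)].
Proof.
move=> mB; rewrite (_ : [set _ | _] = \bigcap_(i in [set: I]) (N (B i) @^-1` A i)).
  apply: fin_bigcap_measurable => // i _; rewrite -[X in measurable X]setTI.
  exact: (measurable_occ R).
by apply/seteqP; split => l /= h i => [_|]; exact: h.
Qed.

Let poisson_list_occ_cover (I : finType) (B : I -> set T) (A : I -> set nat) :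
  (forall i, measurable (B i)) -> trivIset [set: I] B ->
  \bigcup_i B i = [set: T] ->
  poisson_list mu P [set l | forall i, A i (N (B i) l)] =
  \prod_i poisson (mu * fine (P (B i))) (A i).
Proof.
move=> mB tB cB.
(* Singletons are replaced by arbitrary sets one coordinate at a time, by
   countable additivity in that coordinate. *)
suff H (s : seq I) (A' : I -> set nat) :
    (forall i, i \notin s -> exists k, A' i = [set k]) ->
    poisson_list mu P [set l | forall i, A' i (N (B i) l)] =
    \prod_i poisson (mu * fine (P (B i))) (A' i).
  by apply: (H (enum I)) => i; rewrite mem_enum.
elim: s A' => [|i s IH] {}A sA.
  have /choice[k Ak] : forall i, exists k, A i = [set k] by move=> i; exact: sA.
  have -> : A = fun i => [set k i] by exact/funext.
  exact: poisson_list_occ_set1.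
(* [upd n] pins the count of block [i] to [n]; the event is the disjoint union of its pinned
   versions over [n] in [A i]. *)
pose upd n j := if j == i then [set n] else A j.
have updi n : upd n i = [set n] by rewrite /upd eqxx.
have updj n j : j != i -> upd n j = A j by rewrite /upd => /negPf ->.
rewrite (_ : [set _ | _] =
    \bigcup_(n in A i) [set l | forall j, upd n j (N (B j) l)]); last first.
  apply/seteqP; split => [l Al|l [n An h] j].
    exists (N (B i) l); first exact: Al.
    by move=> j; have [->|ji] := eqVneq j i; rewrite ?updi ?updj//; exact: Al.
  have [ji|ji] := eqVneq j i; last by rewrite -(updj n).
  by subst j; have := h i; rewrite updi => ->.
rewrite measure_bigcup//; first last.
- move=> m n _ _ [l [/(_ i) + /(_ i)]] /=.
  by rewrite !updi => -> ->.
- by move=> n _; exact: measurable_occ_box.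
(* Finiteness allows the product over the other coordinates to enter the series as a real scalar. *)
have qfin : \prod_(j | j != i) poisson (mu * fine (P (B j))) (A j) \is a fin_num.
  apply: (big_ind (fun x => x \is a fin_num)) => //.
    by move=> x y; exact: fin_numM.
  by move=> j _; exact: poisson_fin_num.
rewrite (bigD1 i)//= muleC -(fineK qfin) (poisson_sum_set1 _ (A i)).
rewrite -nneseriesZl; last by move=> n _; exact: poisson_ge0.
apply: eq_eseriesr => n _; rewrite fineK// muleC IH.
  rewrite (bigD1 i)//= updi; congr (_ * _).
  by apply: eq_bigr => j ji; rewrite updj.
move=> j js; have [->|ji] := eqVneq j i; first by exists n; rewrite updi.
by rewrite updj//; apply: sA; rewrite inE negb_or ji.
Qed.

Lemma poisson_list_occ (I : finType) (B : I -> set T) (A : I -> set nat) :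
  (forall i, measurable (B i)) -> trivIset [set: I] B ->
  poisson_list mu P [set l : point_list T | forall i, A i (occ (B i) (tagged l))] =
  \prod_i poisson (mu * fine (P (B i))) (A i).
Proof.
move=> mB tB.
(* The index [None] stands for the complement of the family. Its count is left unrestricted, so it
   contributes a factor 1. *)
pose B' (o : option I) := if o is Some i then B i else ~` \bigcup_i B i.
pose A' (o : option I) := if o is Some i then A i else [set: nat].
have mB' o : measurable (B' o).
  by case: o => [i|] /=; [exact: mB|apply: measurableC; exact: fin_bigcup_measurable].
have tB' : trivIset [set: option I] B'.
  move=> [i|] [j|] _ _ //= [x [Bx B'x]].
  - by congr Some; apply: tB => //; exists x.
  - by case: B'x; exists i.
  - by case: Bx; exists j.
have cB' : \bigcup_o B' o = [set: T].
  apply/seteqP; split => // x _; have [[i _ Bi]|nB] := pselect ((\bigcup_i B i) x).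
    by exists (Some i).
  by exists None.
have := poisson_list_occ_cover A' mB' tB' cB'.
rewrite (bigD1 None)//= (reindex_omap Some id)/=; last by case.
under eq_bigl do rewrite eqxx.
have -> r : poisson r [set: nat] = 1 := probability_setT (poisson_prob r 0).
rewrite mul1e => <-; congr (poisson_list _ _ _).
apply/seteqP; split => l h.
  by case => [i|] //=; exact: h.
by move=> i; exact: (h (Some i)).
Qed.

End occurrence_law.

(** * Cylinder events and uniqueness of laws on counting measures *)

Section cylinders.
Context {dT} (T : measurableType dT) (R : realType).
Local Notation counting := (counting_measure T R).

(* [S] need not be measurable: counts only take countably many values. *)
Definition cylinder (I : finType) (B : I -> set T) (S : set (I -> \bar R)) :
  set counting := [set nu | S (fun i => nu (B i))].

Definition cylinders : set (set counting) :=
  [set E | exists (I : finType) (B : I -> set T) (S : set (I -> \bar R)),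
    (forall i, measurable (B i)) /\ E = cylinder B S].

(** Prescribed values are a finite function into [nat], a countable type, so that these events can
    be enumerated through [pickle]. *)
Definition counts_eq (I : finType) (B : I -> set T) (v : {ffun I -> nat}) :
  set counting := [set nu | forall i, nu (B i) = (v i)%:R%:E].

Lemma measurable_counts_eq (I : finType) (B : I -> set T) v :
  (forall i, measurable (B i)) -> measurable (counts_eq B v).
Proof.
move=> mB; rewrite (_ : counts_eq B v = \bigcap_(i in [set: I])
    [set nu : counting | [set (v i)%:R%:E] (nu (B i))]).
  apply: fin_bigcap_measurable => // i _.
  exact: measurable_counting_eval.
by apply/seteqP; split => nu /= h i => [_|]; exact: h.
Qed.

Section enumeration.
Variables (I : finType) (B : I -> set T) (S : set (I -> \bar R)).
Hypothesis mB : forall i, measurable (B i).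

(** Count vectors are indexed by their codes, and integers that code nothing give the empty set. A
    cylinder is the union of the pieces whose vector lies in [S], since counting measures take only
    natural values. *)
Let piece (n : nat) : set counting :=
  if pickle_inv n is Some v then counts_eq B v else set0.

Let hit (n : nat) : Prop :=
  if @pickle_inv {ffun I -> nat} n is Some v then S (fun i => (v i)%:R%:E)
  else False.

Let mpiece n : measurable (piece n).
Proof. by rewrite /piece; case: pickle_inv => // v; exact: measurable_counts_eq. Qed.

Let cylinderE : cylinder B S = \bigcup_(n in hit) piece n.
Proof.
apply/seteqP; split => [nu Snu|nu [n]]; last first.
  rewrite /hit /piece; case: pickle_inv => // v Sv nuv.
  by rewrite /cylinder/= (_ : (fun _ => _) = fun i => (v i)%:R%:E)//; exact/funext.
have /choice[k nuk] : forall i, exists k : nat, nu (B i) = k%:R%:E.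
  by move=> i; exact: counting_valP.
have nukE : (fun i => nu (B i)) = (fun i => ([ffun i => k i] i)%:R%:E).
  by apply/funext => i; rewrite ffunE.
exists (pickle [ffun i => k i]); first by rewrite /hit pickleK_inv -nukE.
by rewrite /piece pickleK_inv => i; rewrite ffunE.
Qed.

Lemma measurable_cylinder : measurable (cylinder B S).
Proof. by rewrite cylinderE; apply: bigcup_measurable => n _; exact: mpiece. Qed.

Lemma eq_measure_cylinder (m1 m2 : {measure set counting -> \bar R}) :
  (forall v, m1 (counts_eq B v) = m2 (counts_eq B v)) ->
  m1 (cylinder B S) = m2 (cylinder B S).
Proof.
(* A measure in two pieces has a single count vector, and the vector determines its code. *)
move=> m12; have tF : trivIset hit piece.
  move=> i j _ _ [nu []]; rewrite /piece.
  case Ei : pickle_inv => [v|//]; case Ej : pickle_inv => [w|//] nuv nuw.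
  have vw : v = w.
    by apply/ffunP => k; apply: (@natr_EFin_inj R); rewrite -nuv -nuw.
  have := @pickle_invK {ffun I -> nat} i; rewrite Ei /= => <-.
  by have := @pickle_invK {ffun I -> nat} j; rewrite Ej /= vw => <-.
rewrite cylinderE !measure_bigcup//; apply: eq_eseriesr => n _.
by rewrite /piece; case: pickle_inv => [v|]; rewrite ?measure0.
Qed.

End enumeration.

(** These are the atoms of the finite algebra generated by the [B i], some possibly empty: [s]
    records exactly which [B i] contain the point. *)
Definition atom (I : finType) (B : I -> set T) (s : {set I}) : set T :=
  [set x | [set i | x \in B i]%SET = s].

Lemma measurable_atom (I : finType) (B : I -> set T) s :
  (forall i, measurable (B i)) -> measurable (atom B s).
Proof.
move=> mB; rewrite (_ : atom B s = \bigcap_(i in [set: I])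
    (if i \in s then B i else ~` B i)).
  apply: fin_bigcap_measurable => // i _.
  by case: ifP => _ //; exact: measurableC.
apply/seteqP; split => [x sE i _|x h].
  by rewrite -sE inE; case: ifPn => [/set_mem//|xB Bx]; rewrite mem_set in xB.
apply/setP => i; have := h i Logic.I; rewrite inE; case: ifP => _ Bx.
  exact/mem_set.
by apply/negbTE/negP => /set_mem.
Qed.

Lemma trivIset_atom (I : finType) (B : I -> set T) : trivIset [set: {set I}] (atom B).
Proof. by move=> s t _ _ [x [<- <-]]. Qed.

Lemma measure_atoms (I : finType) (B : I -> set T)
    (nu : {measure set T -> \bar R}) i : (forall i, measurable (B i)) ->
  nu (B i) = \sum_(s : {set I}) if i \in s then nu (atom B s) else 0.
Proof.
move=> mB; rewrite {1}(_ : B i =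
    \bigcup_(s in [set: {set I}]) (if i \in s then atom B s else set0)).
  rewrite measure_finT_bigcup.
  - by apply: eq_bigr => s _; case: ifP => // _; rewrite measure0.
  - by move=> s; case: ifP => // _; exact: measurable_atom.
  - by move=> s t _ _ [x []]; do 2![case: ifP => // _]; move=> <- <-.
apply/seteqP; split => [x Bx|x [s _]].
  exists [set j | x \in B j]%SET => //; rewrite inE mem_set//.
by case: ifPn => // si sE; move: si; rewrite -sE inE => /set_mem.
Qed.

(** Each [B i] is the disjoint union of the atoms indexed by sets containing [i]. A cylinder over
    overlapping sets thus becomes one over a disjoint family. *)
Lemma cylinder_atoms (I : finType) (B : I -> set T) (S : set (I -> \bar R)) :
  (forall i, measurable (B i)) ->
  cylinder B S = cylinder (atom B)
    [set f | S (fun i => \sum_(s : {set I}) if i \in s then f s else 0)].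
Proof.
move=> mB; apply/seteqP; split => nu; rewrite /cylinder /=;
  rewrite (_ : (fun i => nu (B i)) = fun i =>
    \sum_(s : {set I}) if i \in s then nu (atom B s) else 0)//;
  by apply/funext => i; exact: measure_atoms.
Qed.

(** The two families are juxtaposed over the sum of the index types. Overlaps are harmless, as
    cylinders do not ask for disjoint sets. *)
Lemma cylinders_setI : setI_closed cylinders.
Proof.
move=> _ _ [I [B [S [mB ->]]]] [J [C [U [mC ->]]]].
exists (I + J)%type, (fun k => match k with inl i => B i | inr j => C j end),
  [set f | S (fun i => f (inl i)) /\ U (fun j => f (inr j))].
by split => // -[].
Qed.

Lemma measurable_counting_cylinders :
  @measurable _ counting = <<s cylinders >>.
Proof.
apply/seteqP; split.
  apply: smallest_sub; first exact: smallest_sigma_algebra.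
  move=> _ [B mB [A mA ->]]; apply: sub_sigma_algebra.
  by exists unit, (fun=> B), [set f | A (f tt)].
apply: smallest_sub; first exact: sigma_algebra_measurable.
by move=> _ [I [B [S [mB ->]]]]; exact: measurable_cylinder.
Qed.

(** Passing to atoms extends the agreement from disjoint families to all cylinders, and the
    pi-system argument extends it to the sigma-algebra. *)
Lemma eq_measure_counting (m1 m2 : probability counting R) :
  (forall (J : finType) (C : J -> set T) v,
    (forall j, measurable (C j)) -> trivIset [set: J] C ->
    m1 (counts_eq C v) = m2 (counts_eq C v)) ->
  forall A, measurable A -> m1 A = m2 A.
Proof.
move=> m12 A mA.
apply: (measure_unique cylinders (fun=> setT)) => //.
- exact: measurable_counting_cylinders.
- exact: cylinders_setI.
- by move=> _; exists unit, (fun=> set0), setT.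
- by rewrite bigcup_const.
- move=> _ [I [B [S [mB ->]]]]; rewrite cylinder_atoms//.
  have mC s := measurable_atom s mB.
  apply: eq_measure_cylinder => // v; apply: m12 => //; exact: trivIset_atom.
- by move=> _; exact: le_lt_trans (probability_le1 m1 measurableT) (ltry _).
Qed.

End cylinders.

(** * Counts of a Poisson process, and the list model as a realization *)

Section poisson_process.
Context (R : realType) (d : nat).
Variables (mu : R) (mu0 : (0 <= mu)%R).
Local Notation U := (cube_lebesgue R d).

Lemma poisson_process_counts_eq dO (Omega : measurableType dO)
    (P : probability Omega R) (Xi : {RV P >-> counting_measure (cube R d) R})
    (I : finType) (B : I -> set (cube R d)) v :
  @is_poisson_process _ _ _ _ mu P Xi ->
  (forall i, measurable (B i)) -> trivIset [set: I] B ->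
  P (Xi @^-1` counts_eq B v) =
  \prod_i poisson (mu * fine (U (B i))) [set v i].
Proof.
(* The definition of the process speaks of families indexed by ordinals, while atoms are indexed by
   a finite type; [enum_val] translates. *)
move=> PXi mB tB; pose C (i : 'I_#|I|) := B (enum_val i).
have [||[_ indep] law] := PXi _ C.
- by move=> i; exact: mB.
- by move=> i j _ _ /tB => /(_ Logic.I Logic.I) /enum_val_inj.
have := indep (fun i => [set (v (enum_val i))%:R%:E]) (fun=> emeasurable_set1 _).
rewrite (_ : \bigcap_(i in _) _ = Xi @^-1` counts_eq B v); last first.
  apply/seteqP; split => w /= h i; last by move=> _; exact: h.
  by have := h (enum_rank i) Logic.I; rewrite /C /= enum_rankK.
move=> ->; rewrite [RHS](reindex (@enum_val I predT))/=; last first.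
  exact: onW_bij (enum_val_bij _).
apply: eq_bigr => i _; rewrite (law i).2; last exact: emeasurable_set1.
congr (poisson _ _); apply/seteqP; split => k /=.
  by move/natr_EFin_inj.
by move=> ->.
Qed.

Lemma poisson_list_process :
  @is_poisson_process _ _ _ _ mu (poisson_list mu U) (@list_to_measure _ (cube R d) R).
Proof.
move=> m B mB tB.
have mXi i : measurable_fun [set: point_list (cube R d)]
    (fun l => list_to_measure R l (B i)).
  move=> _ A mA; rewrite setTI.
  have := @measurable_list_to_measure _ (cube R d) R measurableT _
    (measurable_counting_eval (mB i) mA).
  by rewrite setTI.
(* Pulling the sets [A i] back to [nat] reduces the joint law to [poisson_list_occ]. Independence
   then amounts to recognizing each factor as a marginal. *)
have joint (A : 'I_m -> set (\bar R)) :
    poisson_list mu U (\bigcap_(i in [set: 'I_m])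
      ((fun l => list_to_measure R l (B i)) @^-1` A i)) =
    \prod_(i < m) poisson (mu * fine (U (B i)))
      ((fun k : nat => k%:R%:E) @^-1` A i).
  rewrite -poisson_list_occ//; congr (poisson_list _ _ _).
  apply/seteqP; split => l h i; last move=> _.
    by have := h i Logic.I; rewrite /preimage/= -/(list_to_measure R l (B i))
      list_to_measureE.
  by have := h i; rewrite /preimage/= -/(list_to_measure R l (B i))
      list_to_measureE.
have marginal i A : poisson_list mu U
      ((fun l => list_to_measure R l (B i)) @^-1` A) =
    poisson (mu * fine (U (B i))) ((fun k : nat => k%:R%:E) @^-1` A).
  have := joint (fun j => if j == i then A else setT).
  rewrite (bigD1 i)//= eqxx big1 ?mule1; last first.
    move=> j /negPf ->; rewrite preimage_setT.
    exact: (probability_setT (poisson_prob _ 0)).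
  move=> <-; congr (poisson_list _ _ _); apply/seteqP; split => l /=.
    by move=> Al j _; rewrite /preimage/=; case: eqP => [->|].
  by move=> /(_ i Logic.I); rewrite eqxx.
split; last by move=> i; split => // A _; exact: marginal.
split => // A mA; apply: (etrans (joint A)); apply: eq_bigr => i _.
exact/esym/marginal.
Qed.

End poisson_process.

Theorem theorem3p13 (R : realType) (d : nat) (mu : R) :
  (0 < d)%N -> (0 <= mu)%R ->
  exists PPM : probability (point_list (cube R d)) R,
    [/\ has_law PPM (@length _ (cube R d)) (poisson mu),
        forall n : nat, 0 < PPM [set l | length l = n] ->
          iid (conditional PPM (measurable_length_eq n))
              (fun i : 'I_n => @location _ (cube R d) i)
              (cube_lebesgue R d)
      & is_law_of_poisson_process mu
          (distribution PPM (@list_to_measure _ (cube R d) R))].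
Proof.
move=> _ mu0; exists (poisson_list mu (cube_lebesgue R d)); split.
- split; first exact: measurable_length.
  by move=> A _; exact: poisson_list_length.
- by move=> n; exact: iid_poisson_list.
- split.
    exists _, (point_list (cube R d)), (poisson_list mu (cube_lebesgue R d)).
    exists (@list_to_measure _ (cube R d) R).
    split; first exact: poisson_list_process.
    by split => //; exact: measurable_list_to_measure.
  move=> dO Omega P Xi PXi; split; first exact: measurable_funP.
  (* For a disjoint family, an arbitrary realization and the list model give the same product of
     Poisson masses, both being Poisson processes. *)
  apply: (eq_measure_counting (m1 := distribution P Xi)) => J C v mC tC.
  rewrite /= /distribution /pushforward.
  rewrite (poisson_process_counts_eq v PXi)//.
  by rewrite (poisson_process_counts_eq v (poisson_list_process (d := d) mu0)).
Qed.
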